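(* Let $d(k)$ denote the number of positive divisors of the positive integer $k$ and $T(q)=\sum_{k=1}^\infty d(k)\,q^k$ for $|q|<1$. Then the function $$F(q)=\frac{1-q}{q}\left(T(q)-\frac{\log(1-q)}{\log(q)}\right)$$ is strictly decreasing on $(0,1)$.
   Context: $\log$ denotes the natural logarithm. *)

(* Defs.v *)
From Stdlib Require Import Reals.
From Coquelicot Require Import Coquelicot.
From mathcomp Require seq prime.

Open Scope R_scope.

(* Meaningful for [0 < k] only: [prime.divisors 0] is not empty. *)
Definition d (k : nat) : nat := seq.size (prime.divisors k).

(* The index [n] stands for [k = S n]. The series converges for [Rabs q < 1],
   since [d k <= k]; otherwise [Series] returns an unspecified value. *)
Definition T (q : R) : R := Series (fun n => INR (d (S n)) * q ^ (S n)).

Definition F (q : R) : R := (1 - q) / q * (T q - ln (1 - q) / ln q).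

(* Main.v *)
Require Import Defs.
From Stdlib Require Import Reals Lra Lia.
From Coquelicot Require Import Coquelicot.
From mathcomp Require seq prime.

(* Put [L = - ln q] and [phi x = 1 / (1 - exp (- x)) - 1 / x]. Expanding [T] as a
   Lambert series and [ln (1 - q)] as a power series gives
   [F q = sum_(k >= 1) q ^ (k - 1) * (1 - q) * phi (k * L)], where [phi] is positive,
   increasing and concave. Differentiating a partial sum in [L] and summing by
   parts produces the terms
   [k * q ^ (k - 1) * ((1 - q) * phi' (k * L) - q * (phi ((k + 1) * L) - phi (k * L)))],
   and concavity bounds the second difference by [L * phi' (k * L)], so each term is
   at least [k * q ^ (k - 1) * phi' (k * L) * (1 - q - q * L)], which is positive since
   [exp L > 1 + L]. The term [k = 1] alone bounds the derivatives of all partial sums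
   from below, locally uniformly, hence [F] is strictly increasing in [L]. *)

Open Scope R_scope.

(** * Mean value inequality and elementary facts on [exp] and the hyperbolic functions *)

Lemma increment_ge (f df : R -> R) (a b m : R) :
  a <= b ->
  (forall x, a <= x <= b -> is_derive f x (df x)) ->
  (forall x, a <= x <= b -> m <= df x) ->
  m * (b - a) <= f b - f a.
Proof.
  intros Hab Hd Hm.
  destruct (MVT_gen f a b df) as [c [Hc Heq]];
    rewrite ?Rmin_left, ?Rmax_right in * by lra.
  - intros x Hx. apply Hd. lra.
  - intros x Hx. apply derivable_continuous_pt. exists (df x).
    apply is_derive_Reals, Hd, Hx.
  - rewrite Heq. apply Rmult_le_compat_r; [lra | now apply Hm].
Qed.

Lemma pow_exp (x : R) (n : nat) : exp x ^ n = exp (INR n * x).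
Proof.
  induction n as [|n IH].
  - now rewrite Rmult_0_l, exp_0.
  - rewrite S_INR, <- tech_pow_Rmult, IH, <- exp_plus. f_equal. ring.
Qed.

Lemma exp_neg_lt_1 (x : R) : 0 < x -> exp (- x) < 1.
Proof. intros Hx. rewrite <- exp_0. apply exp_increasing. lra. Qed.

Lemma cosh_ge_1 (y : R) : 1 <= cosh y.
Proof.
  unfold cosh. pose proof (exp_pos y) as Hp. rewrite exp_Ropp.
  assert (0 <= (exp y - 1) ^ 2 / exp y).
  { apply Rdiv_le_0_compat; [apply pow2_ge_0 | exact Hp]. }
  replace (exp y + / exp y) with ((exp y - 1) ^ 2 / exp y + 2) by (field; lra).
  lra.
Qed.

(** At [y = x / 2] this is the concavity of [phi] with denominators cleared. *)
Lemma cube_mul_cosh_le_sinh_cube (y : R) : 0 < y -> y ^ 3 * cosh y <= sinh y ^ 3.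
Proof.
  intros Hy.
  (* With [p = cosh ^ (1/3)], it suffices that [sinh t / p t - t] is nondecreasing. *)
  set (p := fun t => exp (ln (cosh t) / 3)).
  assert (Hp3 : forall t, p t ^ 3 = cosh t).
  { intros t. unfold p. rewrite pow_exp.
    replace (INR 3 * (ln (cosh t) / 3)) with (ln (cosh t)) by (simpl; field).
    apply exp_ln. pose proof (cosh_ge_1 t). lra. }
  assert (Hp : forall t, 0 < p t) by (intros t; apply exp_pos).
  set (df := fun t => cosh t / p t - sinh t * (sinh t / cosh t / 3) / p t - 1).
  assert (H : 0 * (y - 0) <= (sinh y / p y - y) - (sinh 0 / p 0 - 0)).
  { apply (increment_ge (fun t => sinh t / p t - t) df); [lra | | ].
    - intros t _. unfold p, df. pose proof (cosh_ge_1 t).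
      apply (is_derive_ext (fun t => sinh t * exp (- (ln (cosh t) / 3)) - t)).
      { intros s. unfold Rdiv at 2. now rewrite exp_Ropp. }
      auto_derive.
      + lra.
      + unfold p. rewrite exp_Ropp. change (ln (cosh t) * / 3) with (ln (cosh t) / 3). field.
        split; [lra | apply Rgt_not_eq, exp_pos].
    - intros t _. unfold df. specialize (Hp t). specialize (Hp3 t).
      assert (Hs : sinh t ^ 2 = p t ^ 6 - 1).
      { replace (p t ^ 6) with ((p t ^ 3) ^ 2) by ring. rewrite Hp3.
        unfold sinh, cosh. rewrite exp_Ropp. pose proof (exp_pos t). field. lra. }
      replace (sinh t * (sinh t / cosh t / 3)) with (sinh t ^ 2 / cosh t / 3)
        by (field; pose proof (cosh_ge_1 t); lra).
      rewrite Hs, <- Hp3.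
      (* With [P = p t ^ 2] the numerator is [2 P^3 - 3 P^2 + 1], which has a double root at
         [P = 1]. *)
      replace (p t ^ 3 / p t - (p t ^ 6 - 1) / p t ^ 3 / 3 / p t - 1)
        with ((p t ^ 2 - 1) ^ 2 * (2 * p t ^ 2 + 1) / (3 * p t ^ 4)) by (field; lra).
      apply Rdiv_le_0_compat.
      + apply Rmult_le_pos; [apply pow2_ge_0 | nra].
      + pose proof (pow_lt _ 4 Hp). lra. }
  rewrite sinh_0 in H. unfold Rdiv at 2 in H.
  specialize (Hp y). rewrite <- Hp3.
  assert (Hyp : y * p y <= sinh y).
  { apply Rmult_le_reg_r with (/ p y); [now apply Rinv_0_lt_compat | ].
    rewrite Rmult_assoc, Rinv_r by lra. unfold Rdiv in H. lra. }
  replace (y ^ 3 * p y ^ 3) with ((y * p y) ^ 3) by ring.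
  apply pow_incr. split; [nra | exact Hyp].
Qed.

(** * Positivity, monotonicity and concavity of [phi] *)

Definition phi (x : R) : R := 1 / (1 - exp (- x)) - 1 / x.
Definition dphi (x : R) : R := 1 / x ^ 2 - exp (- x) / (1 - exp (- x)) ^ 2.
Definition ddphi (x : R) : R :=
  exp (- x) * (1 + exp (- x)) / (1 - exp (- x)) ^ 3 - 2 / x ^ 3.

Lemma is_derive_phi (x : R) : 0 < x -> is_derive phi x (dphi x).
Proof.
  intros Hx. pose proof (exp_neg_lt_1 x Hx). unfold phi, dphi.
  auto_derive; [repeat split; lra | field; split; lra].
Qed.

Lemma is_derive_dphi (x : R) : 0 < x -> is_derive dphi x (ddphi x).
Proof.
  intros Hx. pose proof (exp_neg_lt_1 x Hx). unfold dphi, ddphi.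
  auto_derive.
  - repeat split; repeat apply Rmult_integral_contrapositive_currified; lra.
  - field; split; lra.
Qed.

Lemma ddphi_le_0 (x : R) : 0 < x -> ddphi x <= 0.
Proof.
  intros Hx. unfold ddphi.
  pose proof (cube_mul_cosh_le_sinh_cube (x / 2) ltac:(lra)) as H.
  unfold sinh, cosh in H.
  pose proof (exp_neg_lt_1 (x / 2) ltac:(lra)) as Ha1.
  replace (exp (- x)) with (exp (- (x / 2)) ^ 2)
    by (rewrite pow_exp; f_equal; simpl; field).
  replace (exp (x / 2)) with (/ exp (- (x / 2))) in H
    by (rewrite exp_Ropp, Rinv_inv; reflexivity).
  pose proof (exp_pos (- (x / 2))) as Ha.
  set (a := exp (- (x / 2))) in *.
  (* The hyperbolic inequality at [x / 2], written in [a = exp (- (x / 2))] and multiplied by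
     [16 * a ^ 3]. *)
  assert (H' : x ^ 3 * (a ^ 2 * (1 + a ^ 2)) <= 2 * (1 - a ^ 2) ^ 3).
  { pose proof (pow_lt _ 3 Ha) as Ha3.
    apply (Rmult_le_compat_r (16 * a ^ 3)) in H; [ | lra].
    replace ((x / 2) ^ 3 * ((/ a + a) / 2) * (16 * a ^ 3))
      with (x ^ 3 * (a ^ 2 * (1 + a ^ 2))) in H by (field; lra).
    replace (((/ a - a) / 2) ^ 3 * (16 * a ^ 3))
      with (2 * (1 - a ^ 2) ^ 3) in H by (field; lra).
    exact H. }
  assert (Hb : 0 < 1 - a ^ 2) by nra.
  pose proof (pow_lt _ 3 Hb). pose proof (pow_lt _ 3 Hx).
  apply Rle_minus. apply Rmult_le_reg_r with (x ^ 3 * (1 - a ^ 2) ^ 3).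
  { now apply Rmult_lt_0_compat. }
  replace (a ^ 2 * (1 + a ^ 2) / (1 - a ^ 2) ^ 3 * (x ^ 3 * (1 - a ^ 2) ^ 3))
    with (x ^ 3 * (a ^ 2 * (1 + a ^ 2))) by (field; lra).
  replace (2 / x ^ 3 * (x ^ 3 * (1 - a ^ 2) ^ 3))
    with (2 * (1 - a ^ 2) ^ 3) by (field; lra).
  exact H'.
Qed.

Lemma dphi_decr (x y : R) : 0 < x -> x <= y -> dphi y <= dphi x.
Proof.
  intros Hx Hxy.
  enough (0 * (y - x) <= - dphi y - - dphi x) by lra.
  apply (increment_ge (fun t => - dphi t) (fun t => - ddphi t)); [exact Hxy | | ].
  - intros t Ht. apply (is_derive_opp dphi), is_derive_dphi. lra.
  - intros t Ht. pose proof (ddphi_le_0 t ltac:(lra)). lra.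
Qed.

Lemma phi_increment_le (x y : R) :
  0 < x -> x <= y -> phi y - phi x <= dphi x * (y - x).
Proof.
  intros Hx Hxy.
  enough (- dphi x * (y - x) <= - phi y - - phi x) by lra.
  apply (increment_ge (fun t => - phi t) (fun t => - dphi t)); [exact Hxy | | ].
  - intros t Ht. apply (is_derive_opp phi), is_derive_phi. lra.
  - intros t Ht. pose proof (dphi_decr x t Hx ltac:(lra)). lra.
Qed.

Lemma phi_pos (x : R) : 0 < x -> 0 < phi x.
Proof.
  intros Hx. unfold phi. pose proof (exp_neg_lt_1 x Hx).
  pose proof (exp_ineq1 (- x) ltac:(lra)).
  enough (/ x < / (1 - exp (- x))) by lra.
  apply Rinv_lt_contravar; nra.
Qed.

(** With [a = exp (- (x / 2))], [dphi x] is a difference of squares whose sign is that of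
    [1 - a ^ 2 - x * a], hence that of [sinh (x / 2) - x / 2]. *)
Lemma dphi_pos (x : R) : 0 < x -> 0 < dphi x.
Proof.
  intros Hx.
  pose proof (cube_mul_cosh_le_sinh_cube (x / 2) ltac:(lra)) as H.
  pose proof (exp_neg_lt_1 (x / 2) ltac:(lra)) as Ha1.
  pose proof (exp_pos (- (x / 2))) as Ha.
  unfold dphi.
  replace (exp (- x)) with (exp (- (x / 2)) ^ 2)
    by (rewrite pow_exp; f_equal; simpl; field).
  assert (Hc : 1 < cosh (x / 2)).
  { unfold cosh. replace (exp (x / 2)) with (/ exp (- (x / 2)))
      by (rewrite exp_Ropp, Rinv_inv; reflexivity).
    set (a := exp (- (x / 2))) in *.
    enough (0 < (1 - a) ^ 2 / (2 * a)) as Hq.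
    { replace ((/ a + a) / 2) with ((1 - a) ^ 2 / (2 * a) + 1) by (field; lra). lra. }
    apply Rdiv_lt_0_compat; [apply pow_lt; lra | lra]. }
  (* Otherwise [sinh (x / 2) ^ 3 <= (x / 2) ^ 3], against the cube inequality and
     [cosh (x / 2) > 1]. *)
  assert (Hs : x / 2 < sinh (x / 2)).
  { apply Rnot_le_lt. intros Hle.
    assert (Hs0 : 0 <= sinh (x / 2)).
    { unfold sinh. pose proof (exp_increasing (- (x / 2)) (x / 2) ltac:(lra)). lra. }
    pose proof (pow_incr _ _ 3 (conj Hs0 Hle)) as Hp.
    pose proof (pow_lt (x / 2) 3 ltac:(lra)). nra. }
  unfold sinh in Hs.
  replace (exp (x / 2)) with (/ exp (- (x / 2))) in Hs
    by (rewrite exp_Ropp, Rinv_inv; reflexivity).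
  set (a := exp (- (x / 2))) in *.
  assert (Hxa : x * a < 1 - a ^ 2).
  { apply (Rmult_lt_compat_r (2 * a)) in Hs; [ | lra].
    replace ((/ a - a) / 2 * (2 * a)) with (1 - a ^ 2) in Hs by (field; lra). lra. }
  assert (Hb : 0 < 1 - a ^ 2) by nra.
  replace (1 / x ^ 2 - a ^ 2 / (1 - a ^ 2) ^ 2)
    with ((1 - a ^ 2 - x * a) * (1 - a ^ 2 + x * a) / (x * (1 - a ^ 2)) ^ 2)
    by (field; lra).
  apply Rdiv_lt_0_compat.
  - apply Rmult_lt_0_compat; nra.
  - apply pow_lt. nra.
Qed.

(** * Partial sums of [T] compared with those of the Lambert series *)

(** Counting over a range independent of [k] lets the sums over [k] and over divisors be
    interchanged. *)
Lemma d_eq_count (k M : nat) :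
  (k <= M)%nat ->
  d (S k) = seq.count (fun n => div.dvdn n (S k)) (seq.iota 1 (S M)).
Proof.
  intros Hk. unfold d. rewrite <- seq.size_filter. apply seq.perm_size, seq.uniq_perm.
  - apply prime.divisors_uniq.
  - apply seq.filter_uniq, seq.iota_uniq.
  - intros n. rewrite seq.mem_filter, seq.mem_iota, <- prime.dvdn_divisors by reflexivity.
    destruct (div.dvdn n (S k)) eqn:Hn; [symmetry | reflexivity].
    cbn [andb]. apply andb_true_intro. split.
    + exact (div.dvdn_gt0 (d := n) (m := S k) eq_refl Hn).
    + apply (ssrbool.introT ssrnat.leP).
      pose proof (ssrbool.elimT ssrnat.leP (div.dvdn_leq (d := n) (m := S k) eq_refl Hn)).
      change (S n <= 1 + S M)%nat. lia.
Qed.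

Lemma INR_d (k M : nat) :
  (k <= M)%nat ->
  INR (d (S k)) = sum_n (fun i => if div.dvdn (S i) (S k) then 1 else 0) M.
Proof.
  intros Hk. rewrite (d_eq_count k M Hk). clear Hk. induction M as [|M IH].
  - rewrite sum_O. simpl. now destruct (div.dvdn 1 (S k)).
  - rewrite sum_Sn, <- IH. change (S (S M)) with (1 + S M)%nat at 1.
    replace (1 + S M)%nat with (ssrnat.addn (S M) 1)
      by (change (S M + 1 = 1 + S M)%nat; lia).
    rewrite seq.iotaD, seq.count_cat.
    change ssrnat.addn with Nat.add. rewrite plus_INR. apply f_equal2; [reflexivity | ].
    simpl. now destruct (div.dvdn (S (S M)) (S k)).
Qed.

(* The part of [sum_(j >= 1) q ^ (S i * j)] with exponents at most [N]. *)
Definition trunc_lambert (q : R) (N i : nat) : R :=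
  (q ^ S i - q ^ (S i * S (div.divn N (S i)))) / (1 - q ^ S i).

Lemma pow_S_bounds (q : R) (n : nat) : 0 < q < 1 -> 0 < q ^ S n <= q.
Proof.
  intros Hq. split; [apply pow_lt; lra | ]. simpl.
  pose proof (pow_incr q 1 n ltac:(lra)). rewrite pow1 in *. nra.
Qed.

(** The quotient by [S i] grows by one exactly when [S i] divides [S N], and then the new exponent
    is [S N] itself. *)
Lemma trunc_lambert_S (q : R) (N i : nat) : 0 < q < 1 ->
  trunc_lambert q (S N) i =
  (if div.dvdn (S i) (S N) then 1 else 0) * q ^ S N + trunc_lambert q N i.
Proof.
  intros Hq. unfold trunc_lambert. rewrite (div.divnS N (d := S i) eq_refl).
  destruct (div.dvdn (S i) (S N)) eqn:Hd; simpl ssrnat.nat_of_bool.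
  - assert (He : (S i * S (div.divn N (S i)) = S N)%nat).
    { pose proof (div.divnK Hd) as H1.
      rewrite (div.divnS N (d := S i) eq_refl), Hd in H1.
      change (S (div.divn N (S i)) * S i = S N)%nat in H1. lia. }
    change (ssrnat.addn 1 (div.divn N (S i))) with (S (div.divn N (S i))).
    replace (S i * S (S (div.divn N (S i))))%nat with (S N + S i)%nat by lia.
    rewrite He, pow_add. pose proof (pow_S_bounds q i Hq). field. lra.
  - change (ssrnat.addn 0 (div.divn N (S i))) with (div.divn N (S i)). ring.
Qed.

(** Both sides sum [q ^ (i * j)] over pairs of positive integers with product at most [S N]. Keeping
    [M] apart from [N] fixes the range of divisors during the induction on [N]. *)
Lemma sum_d_trunc_lambert (q : R) (N M : nat) : 0 < q < 1 -> (N <= M)%nat ->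
  sum_n (fun k => INR (d (S k)) * q ^ S k) N = sum_n (trunc_lambert q (S N)) M.
Proof.
  intros Hq.
  assert (Hstep : forall K, (K <= M)%nat ->
    sum_n (trunc_lambert q (S K)) M =
    INR (d (S K)) * q ^ S K + sum_n (trunc_lambert q K) M).
  { intros K HK.
    rewrite (sum_n_ext _ _ M (fun i => trunc_lambert_S q K i Hq)).
    rewrite (INR_d K M HK).
    eapply eq_trans; [apply (sum_n_plus (G := R_AbelianMonoid)) | ].
    apply f_equal2; [ | reflexivity].
    apply (sum_n_mult_r (K := R_Ring) (q ^ S K)
             (fun i => if div.dvdn (S i) (S K) then 1 else 0)). }
  induction N as [|N IH]; intros HN; rewrite Hstep by exact HN.
  - rewrite sum_O.
    rewrite (sum_n_ext (trunc_lambert q 0) (fun _ => 0)), sum_n_const.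
    + rewrite Rmult_0_r. symmetry. apply Rplus_0_r.
    + intros i. unfold trunc_lambert. rewrite div.div0n, Nat.mul_1_r.
      rewrite Rminus_diag. apply Rmult_0_l.
  - rewrite sum_Sn, IH by lia. apply Rplus_comm.
Qed.

Lemma sum_d_error (q : R) (N : nat) : 0 < q < 1 ->
  0 <= sum_n (fun k => q ^ S k / (1 - q ^ S k)) N
       - sum_n (fun k => INR (d (S k)) * q ^ S k) N
    <= INR (S N) * (q ^ S N / (1 - q)).
Proof.
  intros Hq. rewrite (sum_d_trunc_lambert q N N Hq (le_n N)).
  assert (Hterm : forall i,
    0 <= q ^ S i / (1 - q ^ S i) - trunc_lambert q (S N) i <= q ^ S N / (1 - q)).
  { intros i. unfold trunc_lambert. pose proof (pow_S_bounds q i Hq) as Hi.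
    (* [e] is the first multiple of [S i] beyond [S N], so the omitted tail is geometric and starts
       at [q ^ e]. *)
    set (e := (S i * S (div.divn (S N) (S i)))%nat).
    assert (He : (S N <= e)%nat).
    { pose proof (ssrbool.elimT ssrnat.leP (div.ltn_ceil (S N) (d := S i) eq_refl)) as H.
      change (S (S N) <= S (div.divn (S N) (S i)) * S i)%nat in H. lia. }
    replace (q ^ S i / (1 - q ^ S i) - (q ^ S i - q ^ e) / (1 - q ^ S i))
      with (q ^ e / (1 - q ^ S i)) by (field; lra).
    assert (Hpe : 0 < q ^ e <= q ^ S N).
    { split; [apply pow_lt; lra | ].
      replace e with (S N + (e - S N))%nat by lia. rewrite pow_add.
      pose proof (pow_lt q (S N) ltac:(lra)).
      pose proof (pow_incr q 1 (e - S N) ltac:(lra)). rewrite pow1 in *. nra. }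
    split.
    - apply Rdiv_le_0_compat; lra.
    - apply Rmult_le_compat; try lra.
      + left. apply Rinv_0_lt_compat. lra.
      + apply Rinv_le_contravar; lra. }
  assert (Hsum : forall M,
    0 <= sum_n (fun k => q ^ S k / (1 - q ^ S k)) M - sum_n (trunc_lambert q (S N)) M
      <= INR (S M) * (q ^ S N / (1 - q))).
  { induction M as [|M IH].
    - rewrite !sum_O. specialize (Hterm 0%nat). simpl INR. lra.
    - rewrite !sum_Sn, S_INR. change plus with Rplus.
      specialize (Hterm (S M)). lra. }
  apply Hsum.
Qed.

(** * Termwise derivative in [L] and a lower bound uniform in the number of terms *)

(** The index is shifted: [k] stands for the summand of index [k + 1] in the expansion of
    [F (exp (- L))]. *)
Definition term (k : nat) (L : R) : R :=
  exp (- L) ^ k * (1 - exp (- L)) * phi (INR (S k) * L).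

(* The contribution of [k = 1] to the lower bound on the derivative. *)
Definition slope (L : R) : R := dphi L * (1 - (1 + L) * exp (- L)).

(** The first bracket is the derivative of [q ^ k - q ^ S k] at [q = exp (- L)], kept as a
    difference for the summation by parts. *)
Definition dterm (k : nat) (L : R) : R :=
  (INR (S k) * exp (- L) ^ S k - INR k * exp (- L) ^ k) * phi (INR (S k) * L)
  + exp (- L) ^ k * (1 - exp (- L)) * (INR (S k) * dphi (INR (S k) * L)).

Lemma is_derive_term (k : nat) (L : R) : 0 < L -> is_derive (term k) L (dterm k L).
Proof.
  intros HL.
  assert (Hx : 0 < INR (S k) * L) by (apply Rmult_lt_0_compat; [apply lt_0_INR; lia | lra]).
  pose proof (is_derive_phi _ Hx) as Hphi.
  apply (is_derive_ext
    (fun t => exp (- (INR k * t)) * (1 - exp (- t)) * phi (INR (S k) * t))).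
  { intros t. unfold term. rewrite pow_exp.
    now replace (INR k * - t) with (- (INR k * t)) by ring. }
  unfold dterm. rewrite <- tech_pow_Rmult, pow_exp.
  replace (INR k * - L) with (- (INR k * L)) by ring.
  remember (INR (S k)) as c eqn:Hc. rewrite S_INR in Hc.
  auto_derive.
  - now exists (dphi (c * L)).
  - change (Derive (fun x => phi x)) with (Derive phi).
    rewrite (is_derive_unique _ _ _ Hphi). rewrite Hc. ring.
Qed.

Lemma exp_neg_mul_lt_1 (L : R) : 0 < L -> (1 + L) * exp (- L) < 1.
Proof.
  intros HL. pose proof (exp_ineq1 L ltac:(lra)). pose proof (exp_pos (- L)).
  replace 1 with (exp L * exp (- L)) at 2 by (rewrite <- exp_plus, <- exp_0; f_equal; ring).
  now apply Rmult_lt_compat_r.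
Qed.

(** Induction on [N]. The summand beside [slope L] is the boundary term of the summation by parts,
    enlarged by [L * dphi] so that concavity can absorb the next difference of [phi]. At [N = 0]
    equality holds. *)
Lemma sum_dterm_ge (N : nat) (L : R) : 0 < L ->
  slope L + INR (S N) * exp (- L) ^ S N
            * (phi (INR (S N) * L) + L * dphi (INR (S N) * L))
  <= sum_n (fun k => dterm k L) N.
Proof.
  intros HL. pose proof (exp_neg_mul_lt_1 L HL) as Hq. pose proof (exp_pos (- L)) as Hq0.
  induction N as [|N IH].
  - rewrite sum_O. apply Req_le. unfold slope, dterm. simpl.
    replace (1 * L) with L by ring. ring.
  - rewrite sum_Sn. change plus with Rplus. eapply Rle_trans; [ | apply Rplus_le_compat_r, IH].
    unfold dterm. set (q := exp (- L)) in *. set (n := S N).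
    assert (Hn : 0 < INR n) by (apply lt_0_INR; lia).
    assert (Hc : phi (INR (S n) * L) - phi (INR n * L) <= dphi (INR n * L) * L).
    { replace (dphi (INR n * L) * L) with (dphi (INR n * L) * (INR (S n) * L - INR n * L))
        by (rewrite S_INR; ring).
      apply phi_increment_le; rewrite ?S_INR; nra. }
    assert (Hd : 0 < dphi (INR (S n) * L)).
    { apply dphi_pos. rewrite S_INR. nra. }
    rewrite <- !(tech_pow_Rmult q n). pose proof (pow_lt q n Hq0) as Hqn.
    (* The difference of the two sides is exactly the sum of the quantities in [H1] (concavity) and
       [H2] (from [(1 + L) * q < 1]). *)
    assert (H1 : 0 <= INR n * q ^ n *
      (dphi (INR n * L) * L - (phi (INR (S n) * L) - phi (INR n * L)))).
    { apply Rmult_le_pos; [apply Rmult_le_pos |]; lra. }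
    assert (H2 : 0 <= q ^ n * (INR (S n) * dphi (INR (S n) * L)) * (1 - (1 + L) * q)).
    { assert (0 < INR (S n)) by (rewrite S_INR; lra).
      apply Rmult_le_pos; [apply Rmult_le_pos; [ | apply Rmult_le_pos] | ]; lra. }
    lra.
Qed.

(** The factor [dphi] decreases, so it is bounded at [b]; the factor [1 - (1 + t) * exp (- t)]
    increases, so it is bounded at [a]. *)
Lemma slope_ge (a b t : R) : 0 < a -> a <= t <= b ->
  dphi b * (1 - (1 + a) * exp (- a)) <= slope t.
Proof.
  intros Ha [Hat Htb]. unfold slope.
  pose proof (exp_neg_mul_lt_1 a Ha). pose proof (dphi_pos b ltac:(lra)).
  apply Rmult_le_compat; [lra | lra | apply dphi_decr; lra | ].
  pose proof (exp_ineq1_le (t - a)). pose proof (exp_pos (- t)).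
  replace (exp (- a)) with (exp (t - a) * exp (- t))
    by (rewrite <- exp_plus; f_equal; ring).
  (* Follows from [exp (t - a) >= 1 + t - a], as [(1 + a) * (1 + t - a) = 1 + t + a * (t - a)]. *)
  enough (1 + t <= (1 + a) * exp (t - a)) by nra.
  nra.
Qed.

(** The bound does not depend on [N], so it survives the passage to the limit. *)
Lemma sum_term_increment (a b : R) (N : nat) : 0 < a -> a <= b ->
  dphi b * (1 - (1 + a) * exp (- a)) * (b - a)
  <= sum_n (fun k => term k b) N - sum_n (fun k => term k a) N.
Proof.
  intros Ha Hab.
  apply (increment_ge (fun L => sum_n (fun k => term k L) N)
                      (fun L => sum_n (fun k => dterm k L) N)); [exact Hab | | ].
  - intros t Ht. apply (is_derive_sum_n (fun k L => term k L)).
    intros k _. apply is_derive_term. lra.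
  - intros t Ht. eapply Rle_trans; [apply (slope_ge a b t Ha Ht) | ].
    eapply Rle_trans; [ | apply sum_dterm_ge; lra].
    assert (Hx : 0 < INR (S N) * t) by (apply Rmult_lt_0_compat; [apply lt_0_INR; lia | lra]).
    pose proof (phi_pos _ Hx). pose proof (dphi_pos _ Hx).
    pose proof (pow_lt (exp (- t)) (S N) (exp_pos _)).
    enough (0 <= INR (S N) * exp (- t) ^ S N
                 * (phi (INR (S N) * t) + t * dphi (INR (S N) * t))) by lra.
    apply Rmult_le_pos; [apply Rmult_le_pos; [apply pos_INR | lra] | nra].
Qed.

(** * The Lambert series of [T] and the power series of the logarithm *)

(** Writing [q = exp (- h) ^ 2], one factor [exp (- h) ^ n] absorbs [n] because
    [n * h <= exp (n * h)]; the other still tends to 0. *)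
Lemma is_lim_seq_INR_mul_pow (q : R) : 0 < q < 1 ->
  is_lim_seq (fun n => INR n * q ^ n) 0.
Proof.
  intros Hq.
  assert (Hl : ln q < 0) by (rewrite <- ln_1; apply ln_increasing; lra).
  set (h := - ln q / 2). assert (Hh : 0 < h) by (unfold h; lra).
  assert (Hqh : q = exp (- h) * exp (- h)).
  { rewrite <- exp_plus. unfold h.
    replace (- (- ln q / 2) + - (- ln q / 2)) with (ln q) by field.
    symmetry. apply exp_ln. lra. }
  pose proof (exp_pos (- h)) as He. pose proof (exp_neg_lt_1 h Hh) as He1.
  apply is_lim_seq_le_le with (fun _ => 0) (fun n => / h * exp (- h) ^ n).
  - intros n. rewrite Hqh, Rpow_mult_distr. pose proof (pos_INR n).
    pose proof (pow_lt (exp (- h)) n He) as Hp. split.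
    { apply Rmult_le_pos; nra. }
    rewrite <- Rmult_assoc. apply Rmult_le_compat_r; [lra | ].
    rewrite pow_exp. replace (INR n * - h) with (- (INR n * h)) by ring.
    rewrite exp_Ropp. pose proof (exp_ineq1_le (INR n * h)).
    apply Rmult_le_reg_r with (h * exp (INR n * h)).
    { apply Rmult_lt_0_compat; [lra | apply exp_pos]. }
    pose proof (exp_pos (INR n * h)).
    replace (/ h * (h * exp (INR n * h))) with (exp (INR n * h)) by (field; lra).
    replace (INR n * / exp (INR n * h) * (h * exp (INR n * h)))
      with (INR n * h) by (field; lra).
    lra.
  - apply is_lim_seq_const.
  - replace (Finite 0) with (Rbar_mult (/ h) 0) by (simpl; f_equal; ring).
    apply is_lim_seq_scal_l, is_lim_seq_geom. rewrite Rabs_pos_eq; lra.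
Qed.

Lemma ex_series_lambert (q : R) : 0 < q < 1 ->
  ex_series (fun k => q ^ S k / (1 - q ^ S k)).
Proof.
  intros Hq. apply (ex_series_le (V := R_CompleteNormedModule) _ (fun k => / (1 - q) * q ^ k)).
  - intros k. pose proof (pow_S_bounds q k Hq). pose proof (pow_lt q k ltac:(lra)).
    change norm with Rabs. rewrite Rabs_pos_eq by (apply Rdiv_le_0_compat; lra).
    rewrite Rmult_comm. apply Rmult_le_compat; try lra.
    + left. apply Rinv_0_lt_compat. lra.
    + simpl. nra.
    + apply Rinv_le_contravar; lra.
  - apply (ex_series_scal_l (/ (1 - q)) (fun k => q ^ k)), ex_series_geom.
    rewrite Rabs_pos_eq; lra.
Qed.

(** The partial sums of both series differ by a null sequence, so the limit of the Lambert series
    carries over. This also shows that the series defining [T q] converges. *)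
Lemma lambert_series (q : R) : 0 < q < 1 ->
  is_series (fun k => q ^ S k / (1 - q ^ S k)) (T q).
Proof.
  intros Hq. destruct (ex_series_lambert q Hq) as [l Hl].
  enough (T q = l) as -> by exact Hl.
  apply is_series_unique.
  set (a := sum_n (fun k => q ^ S k / (1 - q ^ S k))).
  set (b := sum_n (fun k => INR (d (S k)) * q ^ S k)).
  assert (Herr : is_lim_seq (fun N => a N - b N) 0).
  { apply is_lim_seq_le_le with
      (fun _ => 0) (fun N => / (1 - q) * (INR (S N) * q ^ S N)).
    - intros N. pose proof (sum_d_error q N Hq). unfold a, b.
      replace (/ (1 - q) * (INR (S N) * q ^ S N))
        with (INR (S N) * (q ^ S N / (1 - q))) by (field; lra).
      assumption.
    - apply is_lim_seq_const.
    - replace (Finite 0) with (Rbar_mult (/ (1 - q)) 0) by (simpl; f_equal; ring).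
      apply is_lim_seq_scal_l.
      apply (is_lim_seq_incr_1 (fun n => INR n * q ^ n)).
      now apply is_lim_seq_INR_mul_pow. }
  change (is_lim_seq b l).
  apply (is_lim_seq_ext (fun N => a N - (a N - b N))); [intros N; ring | ].
  replace (Finite l) with (Finite (l - 0)) by (f_equal; ring).
  apply is_lim_seq_minus'; [exact Hl | exact Herr].
Qed.

Lemma ln_series (q : R) : 0 < q < 1 ->
  is_series (fun k => q ^ S k / INR (S k)) (- ln (1 - q)).
Proof.
  intros Hq. change (is_lim_seq (sum_n (fun k => q ^ S k / INR (S k))) (- ln (1 - q))).
  (* The remainder [g N] vanishes at 0 and has derivative [t ^ S N / (1 - t)], so [g N q] lies
     between 0 and [q * q ^ S N / (1 - q)]. *)
  set (g := fun N t => - ln (1 - t) - sum_n (fun k => t ^ S k / INR (S k)) N).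
  assert (Hgeom : forall N t, t < 1 ->
    / (1 - t) - sum_n (fun k => t ^ k) N = t ^ S N / (1 - t)).
  { intros N t Ht. induction N as [|N IH].
    - rewrite sum_O. simpl. field. lra.
    - rewrite sum_Sn. change plus with Rplus.
      replace (/ (1 - t) - (sum_n (fun k => t ^ k) N + t ^ S N))
        with (/ (1 - t) - sum_n (fun k => t ^ k) N - t ^ S N) by ring.
      rewrite IH. simpl. field. lra. }
  assert (Hdg : forall N t, 0 <= t <= q -> is_derive (g N) t (t ^ S N / (1 - t))).
  { intros N t Ht. rewrite <- Hgeom by lra. unfold g.
    apply (is_derive_minus (fun t => - ln (1 - t))
             (fun t => sum_n (fun k => t ^ S k / INR (S k)) N)).
    - auto_derive; [lra | field; lra].
    - apply (is_derive_sum_n (fun k t => t ^ S k / INR (S k))).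
      intros k _. pose proof (lt_0_INR (S k) ltac:(lia)) as Hk.
      remember (INR (S k)) as c eqn:Hc.
      auto_derive; [exact I | ].
      change (1 * (INR (S k) * t ^ k) * / c = t ^ k). rewrite <- Hc. field. lra. }
  assert (Hg0 : forall N, g N 0 = 0).
  { intros N. unfold g. rewrite Rminus_0_r, ln_1.
    rewrite (sum_n_ext _ (fun _ => 0)), sum_n_const.
    - ring.
    - intros k. rewrite pow_i by lia. apply Rmult_0_l. }
  assert (Hlim : is_lim_seq (fun N => g N q) 0).
  { apply is_lim_seq_le_le with (fun _ => 0) (fun N => q / (1 - q) * q ^ S N).
    - intros N.
      assert (Hb : forall t, 0 <= t <= q -> 0 <= t ^ S N / (1 - t) <= q ^ S N / (1 - q)).
      { intros t Ht. pose proof (pow_le t (S N) ltac:(lra)). split.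
        - apply Rdiv_le_0_compat; lra.
        - apply Rmult_le_compat; try lra.
          + left. apply Rinv_0_lt_compat. lra.
          + apply pow_incr. lra.
          + apply Rinv_le_contravar; lra. }
      pose proof (increment_ge (g N) (fun t => t ^ S N / (1 - t)) 0 q 0 ltac:(lra)
                    (Hdg N) (fun t Ht => proj1 (Hb t Ht))) as H1.
      pose proof (increment_ge (fun t => - g N t) (fun t => - (t ^ S N / (1 - t)))
                    0 q (- (q ^ S N / (1 - q))) ltac:(lra)) as H2.
      cbv beta in H2. rewrite Hg0 in H1, H2. split; [lra | ].
      enough (- (q ^ S N / (1 - q)) * (q - 0) <= - g N q - - 0) by lra.
      apply H2.
      + intros t Ht. apply (is_derive_opp (g N)). now apply Hdg.
      + intros t Ht. pose proof (Hb t Ht). lra.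
    - apply is_lim_seq_const.
    - replace (Finite 0) with (Rbar_mult (q / (1 - q)) 0) by (simpl; f_equal; ring).
      apply is_lim_seq_scal_l, (is_lim_seq_incr_1 (fun n => q ^ n)), is_lim_seq_geom.
      rewrite Rabs_pos_eq; lra. }
  apply (is_lim_seq_ext (fun N => - ln (1 - q) - g N q)); [intros N; unfold g; ring | ].
  replace (Finite (- ln (1 - q))) with (Finite (- ln (1 - q) - 0)) by (f_equal; ring).
  apply is_lim_seq_minus'; [apply is_lim_seq_const | exact Hlim].
Qed.

(** * Expansion of [F] and conclusion *)

Lemma F_series (L : R) : 0 < L -> is_series (fun k => term k L) (F (exp (- L))).
Proof.
  intros HL. set (q := exp (- L)).
  assert (Hq : 0 < q < 1) by (split; [apply exp_pos | now apply exp_neg_lt_1]).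
  unfold F. rewrite (ln_exp (- L) : ln q = - L).
  replace ((1 - q) / q * (T q - ln (1 - q) / - L))
    with ((1 - q) / q * (T q - / L * - ln (1 - q))) by (field; lra).
  apply (is_series_ext (fun k =>
    (1 - q) / q * (q ^ S k / (1 - q ^ S k) - / L * (q ^ S k / INR (S k))))).
  { intros k. unfold term, phi. fold q.
    replace (exp (- (INR (S k) * L))) with (q ^ S k)
      by (unfold q; rewrite pow_exp; f_equal; ring).
    pose proof (pow_S_bounds q k Hq). pose proof (lt_0_INR (S k) ltac:(lia)).
    rewrite <- (tech_pow_Rmult q k) at 1 3.
    match goal with |- @eq _ ?u ?v => change (@eq R u v) end. field.
    repeat split; lra. }
  apply (is_series_scal (V := R_NormedModule) ((1 - q) / q)
           (fun k => q ^ S k / (1 - q ^ S k) - / L * (q ^ S k / INR (S k)))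
           (T q - / L * - ln (1 - q))).
  apply (is_series_minus (V := R_NormedModule)).
  - now apply lambert_series.
  - apply (is_series_scal (V := R_NormedModule) (/ L) (fun k => q ^ S k / INR (S k))).
    now apply ln_series.
Qed.

Theorem theorem3p2 (x y : R) (hx : 0 < x) (hxy : x < y) (hy : y < 1) :
  F y < F x.
Proof.
  assert (Ha : 0 < - ln y) by (pose proof (ln_increasing y 1); rewrite ln_1 in *; lra).
  assert (Hab : - ln y < - ln x) by (pose proof (ln_increasing x y); lra).
  (* The substitution [q = exp (- L)] reverses order: the larger point [y] gets the smaller
     parameter [a]. *)
  set (a := - ln y) in *. set (b := - ln x) in *.
  replace y with (exp (- a)) by (unfold a; rewrite Ropp_involutive; apply exp_ln; lra).
  replace x with (exp (- b)) by (unfold b; rewrite Ropp_involutive; apply exp_ln; lra).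
  set (c := dphi b * (1 - (1 + a) * exp (- a)) * (b - a)).
  assert (Hc : 0 < c).
  { pose proof (exp_neg_mul_lt_1 a Ha). pose proof (dphi_pos b ltac:(lra)).
    repeat apply Rmult_lt_0_compat; lra. }
  (* Limits preserve only weak inequalities; strictness comes from the fixed gap [c > 0]. *)
  assert (H : Rbar_le c (F (exp (- b)) - F (exp (- a)))).
  { eapply is_lim_seq_le; [ | apply (is_lim_seq_const c) | apply is_lim_seq_minus'].
    - intros N. apply (sum_term_increment a b N Ha). lra.
    - apply (F_series b). lra.
    - apply (F_series a Ha). }
  simpl in H. lra.
Qed.
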